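(* Let $k\geq 3$ and let $G$ be a graph with maximum degree $\Delta(G)\le k$ that is $0$-saturated. Then $G$ is $(1^{k-1},3)$-packing colorable.
   Context: Graphs are finite and simple; $\mathrm{dist}(x,y)$ is the usual shortest-path distance. For a non-decreasing sequence of positive integers $S=(s_1,\dots,s_p)$, an $S$-packing coloring of $G$ is a partition of $V(G)$ into sets $V_1,\dots,V_p$ such that any two distinct vertices of $V_i$ are at distance greater than $s_i$, for each $1\le i\le p$; $G$ is $S$-packing colorable if such a partition exists. The notation $i^r$ in a sequence means that $i$ is repeated $r$ times, so $(1^{k-1},3)$ is the sequence consisting of $k-1$ ones followed by a single $3$. A vertex of degree $k$ is called a $k$-vertex. A graph $G$ with $\Delta(G)\le k$ is called $t$-saturated ($0\le t\le k$) if every $k$-vertex of $G$ is adjacent to at most $t$ vertices of degree $k$; in particular $0$-saturated means no two vertices of degree $k$ are adjacent. *)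

(* Defs.v *)
From mathcomp Require Import all_boot.
Set Implicit Arguments.
Unset Strict Implicit.
Unset Printing Implicit Defensive.

(* A finite simple graph is a finType of vertices with a symmetric and        *)
(* irreflexive adjacency relation e.                                          *)

Section Graph.
Variables (T : finType) (e : rel T).

Definition neighbors (x : T) : {set T} := [set y | e x y].

Definition degree (x : T) : nat := #|neighbors x|.

Definition max_degree : nat := \max_(x : T) degree x.

Definition saturated (k t : nat) : Prop :=
  forall x : T, degree x = k -> #|[set y in neighbors x | degree y == k]| <= t.

Definition walk_of_length (n : nat) (x y : T) : bool :=
  [exists p : n.-tuple T, path e x p && (last x p == y)].

Lemma connect_walk (x y : T) :
  connect e x y -> exists n, walk_of_length n x y.
Proof.
case/connectP=> p ep ->; exists (size p); apply/existsP.
by exists (in_tuple p); rewrite ep eqxx.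
Qed.

(* None stands for an infinite distance (distinct components).                *)
Definition dist (x y : T) : option nat :=
  if @idP (connect e x y) is ReflectT xy then Some (ex_minn (connect_walk xy))
  else None.

Lemma dist_SomeP (x y : T) (n : nat) :
  dist x y = Some n <->
  walk_of_length n x y /\ (forall m, walk_of_length m x y -> n <= m).
Proof.
rewrite /dist; case: {-}_ / idP => [xy | nxy].
  case: ex_minnP => d wd min_d; split=> [[<-] // | [wn min_n]].
  by congr Some; apply/eqP; rewrite eqn_leq min_d // min_n.
split=> // -[/existsP[p /andP[ep /eqP def_y]] _]; case: nxy.
by apply/connectP; exists p.
Qed.

Definition dist_gt (x y : T) (s : nat) : bool :=
  if dist x y is Some n then s < n else true.

(* The entry s_i of S is nth 0 S i, indices starting at 0; some of the color  *)
(* classes V i may be empty.                                                  *)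
Definition packing_coloring (S : seq nat) (V : 'I_(size S) -> {set T}) : Prop :=
  (forall x : T, exists! i, x \in V i) /\
  (forall (i : 'I_(size S)) (x y : T),
     x \in V i -> y \in V i -> x != y -> dist_gt x y (nth 0 S i)).

Definition packing_colorable (S : seq nat) : Prop :=
  exists V : 'I_(size S) -> {set T}, packing_coloring V.

End Graph.

(* Main.v *)
Require Import Defs.
From mathcomp Require Import all_boot.
From mathcomp Require Import zify.

(** Take a coloring with [m = k - 1] colors that minimizes the number of
    monochromatic edges.  By minimality each vertex has at most one neighbor of
    its own color, so the monochromatic edges form a matching, and a vertex of
    degree at most [k - 1] on such an edge sees every color exactly once: it can
    be given the color of any of its neighbors without losing minimality.  From
    each monochromatic edge put one end of degree at most [k - 1] in the last
    class.  If two of these ends were at distance at most 3, recoloring them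
    (and possibly an inner vertex of degree at most [k - 1] of the path joining
    them) would move both monochromatic edges to a common vertex. *)

Set Implicit Arguments.
Unset Strict Implicit.
Unset Printing Implicit Defensive.

Section MinimalColoring.
Variables (T : finType) (e : rel T) (m : nat).
Hypotheses (e_sym : symmetric e) (e_irr : irreflexive e).
Implicit Types (c : {ffun T -> 'I_m}) (x y v w a b : T) (i : 'I_m).

Definition color_degree c x i : nat := \sum_y (e x y && (c y == i)).

(* Every monochromatic edge is counted twice. *)
Definition mono_count c : nat := \sum_x color_degree c x (c x).

Definition recolor c x i : {ffun T -> 'I_m} :=
  [ffun y => if y == x then i else c y].

Definition optimal c := forall c', mono_count c <= mono_count c'.

Definition clash c x y := e x y && (c x == c y).

Lemma recolor_same c x i : recolor c x i x = i.
Proof. by rewrite ffunE eqxx. Qed.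

Lemma recolor_other c x i y : y != x -> recolor c x i y = c y.
Proof. by rewrite ffunE => /negPf ->. Qed.

Lemma sum_color_degree c x : \sum_i color_degree c x i = degree e x.
Proof.
rewrite exchange_big /= /degree /neighbors -sum1dep_card [RHS]big_mkcond /=.
apply: eq_bigr => y _; rewrite (bigD1 (c y)) //= eqxx andbT big1.
  by case: (e x y).
by move=> i /negPf; rewrite eq_sym => ->; rewrite andbF.
Qed.

Lemma color_degree_recolor c x i j :
  color_degree (recolor c x i) x j = color_degree c x j.
Proof.
apply: eq_bigr => y _; case: (eqVneq y x) => [->|yx]; first by rewrite e_irr.
by rewrite recolor_other.
Qed.

(** Every monochromatic edge at [x] is counted once from each end; the remaining double sum does not
    depend on the color of [x]. *)
Lemma mono_count_split c x :
  mono_count c = (color_degree c x (c x)).*2 +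
    \sum_(u | u != x) \sum_(v | v != x) (e u v && (c v == c u)).
Proof.
rewrite /mono_count (bigD1 x) //= -addnn -addnA; congr (_ + _).
under eq_bigr => u _ do rewrite /color_degree (bigD1 x) //=.
rewrite big_split /=; congr (_ + _).
rewrite /color_degree [RHS](bigD1 x) //= e_irr add0n.
by apply: eq_bigr => u _; rewrite e_sym eq_sym.
Qed.

Lemma mono_count_recolor c x i :
  mono_count (recolor c x i) + (color_degree c x (c x)).*2 =
  mono_count c + (color_degree c x i).*2.
Proof.
rewrite (mono_count_split c x) (mono_count_split (recolor c x i) x).
rewrite recolor_same color_degree_recolor.
rewrite [in LHS](eq_bigr (fun u => \sum_(v | v != x) (e u v && (c v == c u)))).
  by lia.
move=> u ux; apply: eq_bigr => v vx.
by rewrite !recolor_other.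
Qed.

Lemma optimal_color_degree c x i :
  optimal c -> color_degree c x (c x) <= color_degree c x i.
Proof.
by move=> /(_ (recolor c x i)) opt; have := mono_count_recolor c x i; lia.
Qed.

Lemma clash_color_degree c x v : clash c x v -> 0 < color_degree c x (c x).
Proof.
by case/andP=> xv /eqP cxv; rewrite /color_degree (bigD1 v) //= xv cxv eqxx.
Qed.

(** Two neighbors in the color of [x] would, by optimality, force at least two neighbors in each of
    the [m] colors, hence degree at least [2 * m], which exceeds [m.+1]. *)
Lemma optimal_clash_uniq c x v w :
  1 < m -> degree e x <= m.+1 -> optimal c ->
  clash c x v -> clash c x w -> v = w.
Proof.
move=> m_gt1 dx opt /andP[xv /eqP cv] /andP[xw /eqP cw].
apply/eqP/negPn/negP => vw.
have two : 1 < color_degree c x (c x).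
  rewrite /color_degree (bigD1 v) //= (bigD1 w) ?(eq_sym w) //=.
  by rewrite xv xw cv -cw cv eqxx; lia.
have : \sum_(i < m) 2 <= degree e x.
  rewrite -(sum_color_degree c); apply: leq_sum => i _.
  exact: leq_trans two (optimal_color_degree _ _ opt).
by rewrite sum_nat_const card_ord; lia.
Qed.

(** The clash and optimality give [x] a neighbor in each of the [m] colors; as its degree is at most
    [m], there is exactly one in each, so recoloring [x] leaves [mono_count] unchanged. *)
Lemma optimal_recolor c x v i :
  degree e x <= m -> optimal c -> clash c x v -> optimal (recolor c x i).
Proof.
move=> dx opt /clash_color_degree one c'.
suff le1 : color_degree c x i <= 1.
  by have := mono_count_recolor c x i; have := opt c'; lia.
have : color_degree c x i + \sum_(j < m | j != i) 1 <= m.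
  apply: leq_trans dx; rewrite -(sum_color_degree c) [leqRHS](bigD1 i) //=.
  rewrite leq_add2l; apply: leq_sum => j _.
  exact: leq_trans one (optimal_color_degree _ _ opt).
rewrite sum1dep_card -[X in _ <= X]card_ord -(cardC (pred1 i)) card1.
have -> : #|[set j | j != i]| = #|[predC pred1 i]|.
  by apply: eq_card => j; rewrite !inE.
by rewrite leq_add2r.
Qed.

(* One end of degree at most [m] from each monochromatic edge. *)
Definition clash_end c : {set T} :=
  [set x | (degree e x <= m) && [exists v, clash c x v &&
     ((m < degree e v) || (enum_rank x < enum_rank v))]].

Hypothesis big_indep : forall x y, e x y -> (degree e x <= m) || (degree e y <= m).

Lemma clash_in_end c x y :
  clash c x y -> (x \in clash_end c) || (y \in clash_end c).
Proof.
move=> xy; have yx : clash c y x by rewrite /clash e_sym eq_sym.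
have [exy _] := andP xy.
have neq : enum_rank x != enum_rank y :> nat.
  rewrite (inj_eq val_inj) (inj_eq enum_rank_inj).
  by apply: contraTneq exy => ->; rewrite e_irr.
apply/negPn/negP; rewrite negb_or !inE !negb_and !negb_exists.
case/andP=> /orP nx /orP ny.
(* An end of small degree is left out only in favor of another such end of smaller rank. The ranks
   differ, so this cannot happen to both ends. *)
have hx : degree e x <= m -> (degree e y <= m) && (enum_rank y <= enum_rank x).
  by case: nx => [/negP //|/forallP /(_ y)]; rewrite xy /= negb_or -!leqNgt.
have hy : degree e y <= m -> (degree e x <= m) && (enum_rank x <= enum_rank y).
  by case: ny => [/negP //|/forallP /(_ x)]; rewrite yx /= negb_or -!leqNgt.
by case/orP: (big_indep exy) => [/hx|/hy] /andP[d r];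
   [case/andP: (hy d)|case/andP: (hx d)]; move: neq; lia.
Qed.

Hypotheses (m_gt1 : 1 < m) (deg_le : forall x, degree e x <= m.+1).

(** Once [x] takes the color of [y], the vertex [y] clashes with both [x] and [w]. *)
Lemma optimal_clash_dist1 c x y v w :
  optimal c -> degree e x <= m -> e x y ->
  clash c x v -> clash c y w -> w != x -> False.
Proof.
move=> opt dx xy xv yw wx.
have yx : y != x by apply: contraTneq xy => ->; rewrite e_irr.
have opt' := optimal_recolor (c y) dx opt xv.
move: (wx); rewrite (optimal_clash_uniq (v := w) (w := x) m_gt1 (deg_le y) opt').
- by rewrite eqxx.
- by move: yw; rewrite /clash !recolor_other // => ->.
- by rewrite /clash recolor_same recolor_other // e_sym xy eqxx.
Qed.

(** Once [x] and [y] both take the color of [a], the vertex [a] clashes with both. The clash of [y]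
    with [w] survives the first recoloring because [w != x]. *)
Lemma optimal_clash_dist2 c x a y v w :
  optimal c -> degree e x <= m -> degree e y <= m -> x != y ->
  e x a -> e a y -> clash c x v -> clash c y w -> w != x -> False.
Proof.
move=> opt dx dy xy xa ay xv yw wx.
have ax : a != x by apply: contraTneq xa => ->; rewrite e_irr.
have nay : a != y by apply: contraTneq ay => ->; rewrite e_irr.
have opt1 := optimal_recolor (c a) dx opt xv.
have yw1 : clash (recolor c x (c a)) y w.
  by move: yw; rewrite /clash !recolor_other // eq_sym.
have opt2 := optimal_recolor (c a) dy opt1 yw1.
move: (xy); rewrite (optimal_clash_uniq (v := x) (w := y) m_gt1 (deg_le a) opt2).
- by rewrite eqxx.
- by rewrite /clash e_sym xa !(recolor_same, recolor_other) // eqxx.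
- by rewrite /clash ay !(recolor_same, recolor_other) // eqxx.
Qed.

(** Giving [x] the color of [a] and [y] that of [b] moves the clashes to the adjacent vertices [a]
    and [b], one of which has small degree: this is the distance 1 case again. *)
Lemma optimal_clash_dist3 c x a b y v w :
  optimal c -> degree e x <= m -> degree e y <= m -> x != y ->
  (degree e a <= m) || (degree e b <= m) ->
  e x a -> e a b -> e b y -> clash c x v -> clash c y w -> w != x -> False.
Proof.
move=> opt dx dy xy dab xa ab bY xv yw wx.
have ax : a != x by apply: contraTneq xa => ->; rewrite e_irr.
have nby : b != y by apply: contraTneq bY => ->; rewrite e_irr.
have [ay|nay] := eqVneq a y.
  by apply: (@optimal_clash_dist1 c x y v w) => //; rewrite -ay.
have [bx|nbx] := eqVneq b x.
  by apply: (@optimal_clash_dist1 c x y v w) => //; rewrite -bx.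
have opt1 := optimal_recolor (c a) dx opt xv.
have yw1 : clash (recolor c x (c a)) y w.
  by move: yw; rewrite /clash !recolor_other // eq_sym.
have opt2 := optimal_recolor (c b) dy opt1 yw1.
set c2 := recolor _ y _ in opt2.
have ca : clash c2 a x.
  by rewrite /clash e_sym xa !(recolor_same, recolor_other) // eqxx.
have cb : clash c2 b y.
  by rewrite /clash bY !(recolor_same, recolor_other) // eqxx.
case/orP: dab => d.
  by apply: (optimal_clash_dist1 opt2 d ab ca cb); rewrite eq_sym.
by apply: (optimal_clash_dist1 opt2 d _ cb ca); rewrite 1?e_sym // eq_sym.
Qed.

Lemma exists_optimal : exists c, optimal c.
Proof.
have m_gt0 : 0 < m by lia.
case: (arg_minnP mono_count (isT : predT [ffun _ : T => Ordinal m_gt0])).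
by move=> c _ opt; exists c => c'; apply: opt.
Qed.

Lemma clash_end_no_walk c x y n :
  optimal c -> x \in clash_end c -> y \in clash_end c -> x != y ->
  walk_of_length e n x y -> 3 < n.
Proof.
move=> opt; rewrite !inE.
case/andP=> dx /existsP[v /andP[xv rx]] /andP[dy /existsP[w /andP[yw ry]]] xy.
(* Otherwise [x] and [y] are the two ends of one monochromatic edge, and each would need a smaller
   rank than the other. *)
have wx : w != x.
  apply/negP => /eqP wx; subst w.
  have xy' : clash c x y by move: yw; rewrite /clash e_sym eq_sym.
  move: rx ry; rewrite (optimal_clash_uniq m_gt1 (deg_le x) opt xv xy').
  by move: dx dy; lia.
case/existsP=> [[p /= /eqP sz]] /andP[ep /eqP lst].
rewrite ltnNge; apply/negP => n_le3.
case: p sz ep lst => [|a [|b [|d [|? ?]]]] /= sz.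
- by move=> _ xy'; rewrite xy' eqxx in xy.
- case/andP=> xa _ ay; subst a.
  exact: (optimal_clash_dist1 opt dx xa xv yw wx).
- case/and3P=> xa ab _ by_; subst b.
  exact: (optimal_clash_dist2 opt dx dy xy xa ab xv yw wx).
- case/and4P=> xa ab bd _ dy_; subst d.
  exact: (optimal_clash_dist3 opt dx dy xy (big_indep ab) xa ab bd xv yw wx).
- by lia.
Qed.

End MinimalColoring.

Lemma dist_gtP (T : finType) (e : rel T) (x y : T) (s : nat) :
  (forall n, walk_of_length e n x y -> s < n) -> dist_gt e x y s.
Proof.
rewrite /dist_gt; case E: (dist e x y) => [n|] // H.
by apply: H; case/dist_SomeP: E.
Qed.

Theorem theorem2p1 (k : nat) (T : finType) (e : rel T)
  (e_sym : symmetric e) (e_irr : irreflexive e)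
  (k_ge3 : 3 <= k) (max_deg : max_degree e <= k) (sat : saturated e k 0) :
  packing_colorable e (rcons (nseq k.-1 1) 3).
Proof.
case: k k_ge3 max_deg sat => // m m_gt1 max_deg sat; rewrite /= in m_gt1 *.
have deg_le x : degree e x <= m.+1 by apply: leq_trans max_deg; apply: leq_bigmax.
have big_indep x y : e x y -> (degree e x <= m) || (degree e y <= m).
  move=> xy; apply/negPn/negP; rewrite negb_or -!ltnNge => /andP[dx dy].
  have Dx : degree e x = m.+1 by apply/eqP; rewrite eqn_leq deg_le.
  have := sat _ Dx; rewrite leqn0 cards_eq0 => /eqP/setP/(_ y).
  by rewrite !inE xy eqn_leq deg_le dy.
have [c opt] := exists_optimal e m_gt1.
set S := rcons _ _; have szS : size S = m.+1 by rewrite size_rcons size_nseq.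
pose X := clash_end e c.
(* Index [m] is the position of the entry 3; the smaller indices are the colors of [c]. *)
pose col x : nat := if x \in X then m else c x.
have col_lt x : col x < size S.
  by rewrite szS /col; case: ifP => // _; apply: ltnW; rewrite ltnS.
exists (fun i : 'I_(size S) => [set x | col x == i]); split.
  move=> x; exists (Ordinal (col_lt x)); split=> [|j]; rewrite inE //.
  by move/eqP=> cj; apply: val_inj.
move=> i x y; rewrite !inE => /eqP cx /eqP cy xy; apply: dist_gtP => n wn.
rewrite /S nth_rcons size_nseq nth_nseq.
move: cx cy; rewrite /col; case: ifP => xX; case: ifP => yX cx cy.
- rewrite -cx ltnn eqxx.
  exact: (clash_end_no_walk e_sym e_irr big_indep m_gt1 deg_le opt xX yX xy wn).
- by have := ltn_ord (c y); rewrite cy -cx ltnn.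
- by have := ltn_ord (c x); rewrite cx -cy ltnn.
rewrite -{1 2}cx ltn_ord.
(* The entry is now 1, so only walks of length 0 and 1 remain; an edge here would be a clash with
   neither end in [X]. *)
case: n wn => [|[|n]] //; case/existsP=> [[p /= /eqP sz]] /andP[].
  by case: p sz => // _ _ /eqP /= xy'; rewrite xy' eqxx in xy.
case: p sz => [|a [|? ?]] //= _; rewrite andbT => xa /eqP ay; subst a.
have := @clash_in_end _ _ _ e_sym e_irr big_indep c x y.
by rewrite -/X xX yX /clash xa -val_eqE /= cx cy eqxx => /(_ isT).
Qed.
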